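(* Let $k\ge 2$. Let $(f_n^{(k)})_{n\ge0}$ be defined by $f_0^{(k)}=\cdots=f_{k-2}^{(k)}=0$, $f_{k-1}^{(k)}=1$ and $f_n^{(k)}=f_{n-1}^{(k)}+f_{n-2}^{(k)}+\cdots+f_{n-k}^{(k)}$ for $n\ge k$, with characteristic polynomial $f(x)=x^k-x^{k-1}-x^{k-2}-\cdots-x-1$. Let $(g_n^{(k)})_{n\ge0}$ be defined by $g_0^{(k)}=\cdots=g_{k-2}^{(k)}=0$, $g_{k-1}^{(k)}=1$ and $g_n^{(k)}=g_{n-1}^{(k)}+g_{n-k}^{(k)}$ for $n\ge k$, with characteristic polynomial $f(x)=x^k-x^{k-1}-1$. Then, in each of the two cases, the characteristic polynomial $f(x)$ has a dominant zero $\lambda$ such that $f'(\lambda)>1$. Consequently, the sequences $\sqrt[n]{f_n^{(k)}}$ and $\sqrt[n]{g_n^{(k)}}$ are log-concave for all $n\ge N$, for some constant $N$ depending on $k$.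
   Context: A zero of a polynomial $g$ (among its complex zeros) is called dominant if it is simple and is strictly greater in modulus than all of the other zeros of $g$. A sequence $(y_n)$ is log-concave if the sequence of ratios $\frac{y_n}{y_{n-1}}$ is decreasing; ''log-concave for all $n\ge N$'' means that the ratios $\frac{y_n}{y_{n-1}}$ are defined (nonzero denominators) and decreasing for $n\ge N$, i.e. $\frac{y_n}{y_{n-1}}\ge\frac{y_{n+1}}{y_n}$ for all $n\ge N$. For $y\ge 0$ and an integer $n\ge1$, $\sqrt[n]{y}$ denotes the non-negative real $n$-th root. For $k=2$ both recurrences are the Fibonacci recurrence $a_n=a_{n-1}+a_{n-2}$, with characteristic polynomial $x^2-x-1$. *)

(* Defs.v *)
From mathcomp Require Import all_boot all_order all_algebra complex.
From mathcomp Require Import reals exp.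

Set Implicit Arguments.
Unset Strict Implicit.
Unset Printing Implicit Defensive.

Import Order.TTheory GRing.Theory Num.Theory.
Local Open Scope ring_scope.

Definition f_sequence (k : nat) (f : nat -> nat) : Prop :=
  [/\ forall n, (n < k.-1)%N -> f n = 0%N,
      f k.-1 = 1%N
    & forall n, (k <= n)%N -> f n = (\sum_(1 <= i < k.+1) f (n - i))%N].

Definition g_sequence (k : nat) (g : nat -> nat) : Prop :=
  [/\ forall n, (n < k.-1)%N -> g n = 0%N,
      g k.-1 = 1%N
    & forall n, (k <= n)%N -> g n = (g (n - 1) + g (n - k))%N].

Definition f_charpoly (A : nzRingType) (k : nat) : {poly A} :=
  'X^k - \sum_(i < k) 'X^i.

Definition g_charpoly (A : nzRingType) (k : nat) : {poly A} :=
  'X^k - 'X^(k.-1) - 1.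

(* [mup z p = 1] says that z is a zero of p and is simple. C is meant to be the
   field R[i] of complex numbers. *)
Definition dominant_zero (C : numClosedFieldType) (p : {poly C}) (z : C) :
    Prop :=
  mup z p = 1%N /\ forall w : C, root p w -> w != z -> `|w| < `|z|.

(* The non-negative n-th root of y; only meaningful for 0 <= y and 1 <= n. *)
Definition real_nthroot (R : realType) (n : nat) (y : R) : R := powR y n%:R^-1.

(* Division by 0 is total, so that the ratios are defined is required
   explicitly. *)
Definition log_concave_from (R : realType) (N : nat) (y : nat -> R) : Prop :=
  forall n, (N <= n)%N ->
    y n.-1 != 0 /\ y n.+1 / y n <= y n / y n.-1.

(* Main.v *)
Require Import Defs.
From mathcomp Require Import all_boot all_order all_algebra complex.
From mathcomp Require Import reals sequences exp.
From mathcomp Require Import ring lra.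

Import Order.TTheory GRing.Theory Num.Theory.
Local Open Scope ring_scope.

(** Both characteristic polynomials have the form
    P = X^(d+1) - sum_(i <= d) a_i X^i with natural coefficients a_i such that
    a_0 and a_d are positive, where k = d+1 >= 2; the proof treats all of them
    at once.

    Zeros.  As P(1) <= 0 and P is positive far to the right, P has a real zero
    x >= 1 ([rec_poly_root_ge1]).  Subtracting (d+1) P(x) = 0 from x P'(x)
    leaves x P'(x) = sum_i (d+1-i) a_i x^i, a sum of nonnegative terms whose
    term i = 0 is positive and whose term i = d is at least x; hence P'(x) > 1
    ([rec_poly_deriv_gt1]), and x is simple.  A zero w satisfies
    1 = sum_i a_i w^(i-d-1).  If |w| >= x, the moduli of these terms are at most
    those of the corresponding terms at x, whose sum is also 1, so the two sums
    agree term by term; the term i = d says w = x ([rec_poly_root_dominant]).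

    Asymptotics.  If s obeys the recurrence and starts with 0, ..., 0, 1, then
    h_n = s_n / x^n is a weighted average of its d+1 predecessors, with weights
    p_i = a_i x^i / x^(d+1).  Over every d+1 steps the oscillation of h on a
    window of length d+1 shrinks by a constant factor ([window_contraction]):
    the oldest value lies in one half of the range, and as p_0 and p_d are
    positive, it pulls all the values of the next window away from the opposite
    end.  The limit is found from the conserved quantity
    sum_i (p_0 + ... + p_i) h_(n+i) ([averaging_invariant]): it is
    c = 1 / P'(x), which lies in every window range.  So h_n tends to c
    geometrically fast.

    Log-concavity.  The logarithm of the n-th root of s_n is
    ln x + ln c / n + o(1/n^3).  The second difference of ln c / n is
    2 ln c / ((n-1) n (n+1)), which dominates the error term, and it is negative
    exactly because c < 1, that is, because P'(x) > 1
    ([log_concave_nthroot]). *)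

(** * Zeros of the characteristic polynomials *)

Lemma mup_simple_root (F : fieldType) (p : {poly F}) (z : F) :
  root p z -> p^`().[z] != 0 -> mup z p = 1%N.
Proof.
move=> pz dpz.
have p0 : p != 0 by apply: contraNneq dpz => ->; rewrite deriv0 horner0.
apply/eqP; rewrite eqn_leq -XsubC_dvd // dvdp_XsubCl pz andbT mup_leq //.
apply: contra dpz => /dvdpP [q ->].
by rewrite derivM deriv_exp !hornerE subrr /= expr1 !(mulr0, mul0r, addr0).
Qed.

(** The coefficients are natural numbers so that one [a] serves the recurrence
    over [nat] and the polynomial over any ring. *)
Definition rec_poly (A : nzRingType) (d : nat) (a : nat -> nat) : {poly A} :=
  'X^(d.+1) - \sum_(i < d.+1) 'X^i *+ a i.

Lemma horner_rec_poly (A : comNzRingType) d a (x : A) :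
  (rec_poly A d a).[x] = x ^+ d.+1 - \sum_(i < d.+1) x ^+ i *+ a i.
Proof.
rewrite /rec_poly hornerD hornerN hornerXn horner_sum; congr (_ - _).
by apply: eq_bigr => i _; rewrite hornerMn hornerXn.
Qed.

Lemma root_rec_polyP (A : comNzRingType) d a (x : A) :
  root (rec_poly A d a) x -> x ^+ d.+1 = \sum_(i < d.+1) x ^+ i *+ a i.
Proof.
by move/rootP; rewrite horner_rec_poly => /eqP; rewrite subr_eq0 => /eqP.
Qed.

Lemma map_rec_poly (A B : nzRingType) (phi : {rmorphism A -> B}) d a :
  map_poly phi (rec_poly A d a) = rec_poly B d a.
Proof.
rewrite /rec_poly rmorphB rmorph_sum /= map_polyXn; congr (_ - _).
by apply: eq_bigr => i _; rewrite rmorphMn /= map_polyXn.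
Qed.

(** Euler's operator X d/dX multiplies the monomial of degree i by i; at a zero,
    the leading term (d+1) x^(d+1) may be spread over the lower ones. *)
Lemma root_deriv_rec_poly (A : comNzRingType) d a (x : A) :
  root (rec_poly A d a) x ->
  x * (rec_poly A d a)^`().[x] =
    \sum_(i < d.+1) x ^+ i *+ (a i * (d.+1 - i))%N.
Proof.
move=> /root_rec_polyP Ex.
have xD n : x * ('X^n)^`().[x] = x ^+ n *+ n.
  by rewrite derivXn hornerMn hornerXn mulrnAr; case: n => // n; rewrite exprS.
rewrite /rec_poly derivB hornerD hornerN mulrBr xD Ex -sumrMnl.
rewrite raddf_sum /= horner_sum mulr_sumr -sumrB.
apply: eq_bigr => i _; rewrite derivMn hornerMn mulrnAr xD -!mulrnA.
by rewrite mulnBr [(i * _)%N]mulnC mulrnBr // leq_mul2l ltnW ?orbT.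
Qed.

Section RealRoot.
Variables (R : rcfType) (d : nat) (a : nat -> nat).
Hypotheses (d_gt0 : (0 < d)%N) (a0 : (0 < a 0)%N) (ad : (0 < a d)%N).

(** The intermediate value theorem on [1, B] with B = 1 + sum_i a_i: there
    sum_i a_i B^i <= (sum_i a_i) B^d <= B^(d+1). *)
Lemma rec_poly_root_ge1 : exists2 x : R, 1 <= x & root (rec_poly R d a) x.
Proof.
pose B : R := 1 + \sum_(i < d.+1) (a i)%:R.
have B1 : 1 <= B by rewrite lerDl sumr_ge0.
suff /(poly_ivt B1)[x /andP[x1 _] xr] :
    (rec_poly R d a).[1] <= 0 <= (rec_poly R d a).[B] by exists x.
rewrite !horner_rec_poly; apply/andP; split.
  rewrite expr1n subr_le0 (eq_bigr (fun i : 'I_d.+1 => (a i)%:R)); last first.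
    by move=> i _; rewrite expr1n.
  rewrite big_ord_recl /= -[leLHS]addr0 lerD ?sumr_ge0 //.
  by rewrite ler1n.
rewrite subr_ge0 exprS.
apply: le_trans (_ : \sum_(i < d.+1) B ^+ d *+ a i <= _).
  apply: ler_sum => i _; rewrite lerMn2r; apply/orP; right.
  by rewrite ler_weXn2l // -ltnS.
rewrite mulrDl mul1r mulr_suml -[leLHS]add0r lerD ?exprn_ge0 ?(le_trans _ B1) //.
by apply: ler_sum => i _; rewrite mulr_natl.
Qed.

Lemma rec_poly_deriv_gt1 (x : R) :
  1 <= x -> root (rec_poly R d a) x -> 1 < (rec_poly R d a)^`().[x].
Proof.
move=> x1 xr; have x0 : 0 < x by apply: lt_le_trans x1.
rewrite -(ltr_pM2l x0) mulr1 root_deriv_rec_poly //.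
rewrite (bigD1 ord0) //= (bigD1 ord_max) /=; last by rewrite -lt0n.
(* The term i = d alone is at least x, as 0 < d and 1 <= x. *)
have xd : x <= x ^+ d *+ (a d * (d.+1 - d)).
  rewrite subSnn muln1 (@le_trans _ _ (x ^+ d)) //.
    by rewrite -{1}[x]expr1 ler_weXn2l.
  by rewrite -{1}[x ^+ d]mulr1n ler_pMn2l ?exprn_gt0.
have T0 : 0 < x ^+ 0 *+ (a 0 * (d.+1 - 0)) :> R.
  by rewrite expr0 ltr0n muln_gt0 a0.
set S := \sum_(i < _ | _) _.
have S0 : 0 <= S by apply: sumr_ge0 => i _; rewrite mulrn_wge0 // exprn_ge0 ?ltW.
move: xd T0 S0; lra.
Qed.

End RealRoot.

(** Equality case of the triangle inequality: after division by w^(d+1), the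
    equations of w and of x are two sums with the same value 1, and the terms of
    the first are bounded in modulus by those of the second as soon as
    x <= |w|. *)
Lemma rec_poly_root_dominant (C : numClosedFieldType) d a (x w : C) :
    (0 < a d)%N -> 0 < x -> root (rec_poly C d a) x ->
  root (rec_poly C d a) w -> w != x -> `|w| < `|x|.
Proof.
move=> ad x0 /root_rec_polyP xr /root_rec_polyP wr; apply: contraNT.
rewrite (ger0_norm (ltW x0)) -real_leNgt ?normr_real ?gtr0_real // => xw.
have xn0 : x != 0 by rewrite gt_eqF.
have w0 : w != 0 by rewrite -normr_gt0; apply: lt_le_trans xw.
pose F (y : C) (i : 'I_d.+1) := y ^+ i *+ a i / y ^+ d.+1.
have F1 (y : C) : y != 0 -> y ^+ d.+1 = \sum_(i < d.+1) y ^+ i *+ a i ->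
    \sum_i F y i = 1.
  by move=> y0 yr; rewrite -mulr_suml -yr divff // expf_neq0.
have FE (y : C) i : y != 0 -> F y i = (y ^- (d.+1 - i)) *+ a i.
  move=> y0; rewrite /F mulrnAl -{2}(subnK (ltnW (ltn_ord i))) exprD.
  by rewrite invfM mulrC mulfVK // expf_neq0.
have /(_ ord_max isT) : forall i, true -> F w i = F x i.
  apply: normC_sum_upper => [i _|]; last by rewrite !F1.
  rewrite !FE // normrMn normrV ?unitfE ?expf_neq0 // normrX.
  rewrite lerMn2r; apply/orP; right.
  rewrite lef_pV2 ?posrE ?exprn_gt0 ?normr_gt0 //.
  by rewrite lerXn2r ?nnegrE ?normr_ge0 // ltW.
rewrite !FE //= subSnn !expr1 => /eqP.
by rewrite eqrMn2r (gtn_eqF ad) /= => /eqP /invr_inj ->.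
Qed.

Lemma rec_poly_dominant_zero (R : rcfType) d a (x : R) :
    (0 < d)%N -> (0 < a 0)%N -> (0 < a d)%N -> 1 <= x ->
    root (rec_poly R d a) x ->
  dominant_zero (rec_poly R[i] d a) (x%:C)%C /\
  1 < (rec_poly R[i] d a)^`().[(x%:C)%C].
Proof.
move=> d_gt0 a0 ad x1 xr.
have xrC : root (rec_poly R[i] d a) (x%:C)%C.
  by rewrite -(map_rec_poly _ _ (real_complex R)) rmorph_root.
have dC : 1 < (rec_poly R[i] d a)^`().[(x%:C)%C].
  rewrite -(map_rec_poly _ _ (real_complex R)) deriv_map horner_map /=.
  by rewrite -[1]/((1 : R)%:C)%C ltcR rec_poly_deriv_gt1.
split=> //; split=> [|w wr wx].
  by apply: mup_simple_root => //; rewrite gt_eqF // (lt_trans ltr01).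
apply: rec_poly_root_dominant wr wx => //.
by rewrite -[0]/((0 : R)%:C)%C ltcR (lt_le_trans ltr01).
Qed.

(** * Sequences of weighted averages *)

Section WeightedAverage.
Variables (R : realFieldType) (d : nat) (p : nat -> R).
Hypotheses (p_ge0 : forall i, 0 <= p i) (p_sum1 : \sum_(i < d.+1) p i = 1).

Definition averaging (h : nat -> R) :=
  forall n, h (n + d.+1)%N = \sum_(i < d.+1) p i * h (n + i)%N.

Definition bounded_on_window (h : nat -> R) n m M :=
  forall i, (i <= d)%N -> m <= h (n + i)%N <= M.

Lemma averagingN h : averaging h -> averaging (fun n => - h n).
Proof.
by move=> hA n; rewrite hA -sumrN; apply: eq_bigr => i _; rewrite mulrN.
Qed.

(** An excess e over the lower bound m in one place of the window contributes
    p_j e to the next value. *)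
Lemma averaging_ge h n m e j : averaging h ->
    (forall i, (i <= d)%N -> m <= h (n + i)%N) -> (j <= d)%N ->
  m + e <= h (n + j)%N -> m + p j * e <= h (n + d.+1)%N.
Proof.
move=> hA hm jd hj; rewrite hA.
have jd1 : (j < d.+1)%N by [].
rewrite -[m in leLHS]mul1r -p_sum1 mulr_suml (bigD1 (Ordinal jd1)) //=.
rewrite [leRHS](bigD1 (Ordinal jd1)) //= addrAC -mulrDr.
apply: lerD; first by rewrite ler_wpM2l.
by apply: ler_sum => i _; rewrite ler_wpM2l // hm // -ltnS.
Qed.

Lemma averaging_ge_forever h n m : averaging h ->
    (forall i, (i <= d)%N -> m <= h (n + i)%N) ->
  forall i, m <= h (n + i)%N.
Proof.
move=> hA hm; elim/ltn_ind => i IH.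
have [id|di] := leqP i d; first exact: hm.
rewrite -(subnK di) addnA -[m]addr0 -(mulr0 (p 0)).
apply: averaging_ge => // [j jd|]; last first.
  by rewrite addr0 addn0 IH // ltn_subrL /= (leq_ltn_trans _ di).
rewrite -addnA IH // -{2}(subnK di) ltn_add2l ltnS //.
Qed.

Hypothesis p0_gt0 : 0 < p 0.
Hypothesis pd_gt0 : 0 < p d.

Lemma weight_le1 i : (i <= d)%N -> p i <= 1.
Proof.
rewrite -ltnS => id; rewrite -p_sum1 (bigD1 (Ordinal id)) //= lerDl.
by apply: sumr_ge0.
Qed.

(** The proportion of the oscillation that is lost from one window to the next:
    a factor 1/2 for the distance of h_n from the farther end of the range, p_0
    for its effect on h_(n+d+1), and at most d factors p_d to hand that effect
    on from each value to its successor. *)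
Definition gain : R := p 0 * p d ^+ d / 2.

Lemma gain_gt0 : 0 < gain.
Proof. by rewrite !mulr_gt0 ?exprn_gt0 ?invr_gt0. Qed.

Lemma gain_lt1 : gain < 1.
Proof.
have pd : p 0 * p d ^+ d <= 1.
  by rewrite mulr_ile1 ?exprn_ge0 ?weight_le1 // exprn_ile1 // weight_le1.
by move: pd; rewrite /gain; lra.
Qed.

Lemma window_gain h n m M : averaging h ->
    (forall i, (i <= d)%N -> m <= h (n + i)%N) -> m <= M ->
    (m + M) / 2 <= h n ->
  forall i, (i <= d)%N -> m + gain * (M - m) <= h (n + d.+1 + i)%N.
Proof.
move=> hA hm mM hn i id.
pose e := (M - m) / 2; have e0 : 0 <= e by rewrite /e; move: mM; lra.
have hm' := averaging_ge_forever _ _ _ hA hm.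
apply: le_trans (_ : m + p 0 * p d ^+ i * e <= _).
  rewrite lerD2l /gain -mulrA -[2^-1 * _]mulrC ler_wpM2r //.
  by rewrite ler_wpM2l // ler_wiXn2l // weight_le1.
(* h_(n+d+1) feels h_n through p_0; each later value feels the one just before
   it through p_d. *)
elim: i {id} => [|i IH].
  rewrite addn0 expr0 mulr1; apply: averaging_ge => //.
  by rewrite addn0 /e; move: hn; lra.
have -> : p 0 * p d ^+ i.+1 * e = p d * (p 0 * p d ^+ i * e).
  by rewrite exprS; ring.
rewrite addnAC; apply: averaging_ge => // [j _|].
  by rewrite -addnA hm'.
by rewrite addnAC !addnS -addSn -addnS.
Qed.

(** If h_n is in the upper half of the range, the lower bound rises; otherwise
    the same argument for - h makes the upper bound fall. *)
Lemma window_contraction h n m M : averaging h -> bounded_on_window h n m M ->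
  exists m' M', M' - m' = (1 - gain) * (M - m) /\
    bounded_on_window h (n + d.+1) m' M'.
Proof.
move=> hA hmM.
have hm i : (i <= d)%N -> m <= h (n + i)%N by move=> /hmM /andP[].
have hM i : (i <= d)%N -> - M <= - h (n + i)%N.
  by move=> /hmM /andP[_]; rewrite lerN2.
have hm' := averaging_ge_forever _ _ _ hA hm.
have hM' := averaging_ge_forever _ _ _ (averagingN _ hA) hM.
have mM : m <= M by have /andP[] := hmM 0 isT; apply: le_trans.
have [mid|mid] := leP ((m + M) / 2) (h n).
  exists (m + gain * (M - m)), M; split; first by lra.
  move=> i id; rewrite window_gain //=.
  by rewrite -lerN2 -addnA hM'.
exists m, (M - gain * (M - m)); split; first by lra.
move=> i id; rewrite -addnA hm' /= -lerN2 opprB addrC addnA.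
have -> : M - m = - m - - M by lra.
apply: (window_gain (fun n => - h n)) => //; first exact: averagingN.
- by rewrite lerN2.
- by move: mid; lra.
Qed.

Definition cumul (i : nat) : R := \sum_(j < i.+1) p j.

Lemma sum_cumul n : \sum_(i < n) cumul i = \sum_(j < n) p j *+ (n - j).
Proof.
elim: n => [|n IH]; first by rewrite !big_ord0.
have -> : \sum_(j < n.+1) p j *+ (n.+1 - j) =
    \sum_(j < n.+1) p j *+ (n - j) + cumul n.
  rewrite -big_split; apply: eq_bigr => j _ /=.
  by rewrite subSn ?mulrSr // -ltnS.
by rewrite big_ord_recr IH [in RHS]big_ord_recr /= subnn mulr0n addr0.
Qed.

(** Moving the window by one place replaces the coefficient of h_(n+i+1) from
    [cumul i.+1] by [cumul i]; the missing p_(i+1) h_(n+i+1), together with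
    p_0 h_n, add up to the new value h_(n+d+1), whose coefficient [cumul d]
    is 1. *)
Lemma averaging_invariant h n : averaging h ->
  \sum_(i < d.+1) cumul i * h (n + i)%N = \sum_(i < d.+1) cumul i * h i.
Proof.
move=> hA; elim: n => // n <-.
have cumul0 : cumul 0 = p 0 by rewrite /cumul big_ord1.
have cumulS i : cumul i.+1 = cumul i + p i.+1 by rewrite /cumul big_ord_recr.
rewrite big_ord_recr /= [cumul d]p_sum1 mul1r addSnnS hA.
rewrite [X in _ + X]big_ord_recl [RHS]big_ord_recl /= cumul0.
rewrite addrCA; congr (_ + _); rewrite -big_split; apply: eq_bigr => i _ /=.
by rewrite /bump /= add1n addSnnS -mulrDl cumulS.
Qed.

(** A constant sequence with the same value of the invariant as [h] must take
    this value. *)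
Definition average_limit (h : nat -> R) : R :=
  (\sum_(i < d.+1) cumul i * h i) / \sum_(i < d.+1) cumul i.

Lemma cumul_gt0 i : 0 < cumul i.
Proof. by rewrite /cumul big_ord_recl ltr_pwDl // sumr_ge0. Qed.

Lemma average_limit_in_window h n m M : averaging h ->
  bounded_on_window h n m M -> m <= average_limit h <= M.
Proof.
move=> hA hmM.
have c0 : 0 < \sum_(i < d.+1) cumul i.
  rewrite big_ord_recl ltr_pwDl ?cumul_gt0 // sumr_ge0 // => i _.
  exact/ltW/cumul_gt0.
rewrite /average_limit ler_pdivlMr // ler_pdivrMr // -(averaging_invariant h n hA).
rewrite !mulr_sumr; apply/andP; split; apply: ler_sum => i _;
  rewrite [_ * cumul _]mulrC ler_wpM2l ?(ltW (cumul_gt0 _)) //;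
  by have /andP[] : m <= h (n + i)%N <= M by apply: hmM; rewrite -ltnS.
Qed.

(** The limit and the values of a window share an interval, whose length is
    multiplied by [1 - gain] from one block of d+1 indices to the next. *)
Lemma averaging_geometric h : averaging h ->
  exists2 D, 0 <= D & forall t i, (i <= d)%N ->
    `|h (t * d.+1 + i)%N - average_limit h| <= D * (1 - gain) ^+ t.
Proof.
move=> hA.
pose D := \sum_(i < d.+1) `|h i|.
exists (2 * D) => [|t]; first by rewrite mulr_ge0 // sumr_ge0.
suff [m [M [MmD hmM]]] : exists m M, M - m = 2 * D * (1 - gain) ^+ t /\
    bounded_on_window h (t * d.+1) m M.
  move=> i id; have /andP[] := average_limit_in_window _ _ _ _ hA hmM.
  by have /andP[] := hmM i id; rewrite -MmD ler_norml; lra.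
elim: t => [|t [m [M [MmD hmM]]]].
  exists (- D), D; split=> [|i]; first by rewrite expr0; ring.
  rewrite -ltnS => id; rewrite mul0n add0n -ler_norml.
  by rewrite /D (bigD1 (Ordinal id)) //= lerDl sumr_ge0.
have [m' [M' [E hmM']]] := window_contraction _ _ _ _ hA hmM.
exists m', M'; rewrite E MmD mulSn addnC; split=> //.
by rewrite exprS; ring.
Qed.

End WeightedAverage.

(** * Log-concavity of n-th roots *)

Section LogConcavity.
Variable R : realType.

(** The rate o(1/n^2) is what the second difference of ln (h n) / n requires. *)
Definition fast_cvg (h : nat -> R) (c : R) :=
  forall eta, 0 < eta ->
    exists N, forall n, (N <= n)%N -> n%:R ^+ 2 * `|h n - c| <= eta.

Lemma sqr_geometric_le (r : R) : 0 < r < 1 -> forall eta, 0 < eta ->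
  exists T, forall t, (T <= t)%N -> t.+1%:R ^+ 2 * r ^+ t <= eta.
Proof.
move=> /andP[r0 r1] eta eta0.
pose al := - ln r; have al0 : 0 < al by rewrite oppr_gt0 ln_lt0 // r0.
have a3 : 0 < al ^+ 3 * eta by rewrite mulr_gt0 ?exprn_gt0.
have B0 : 0 <= 24 / (al ^+ 3 * eta) by rewrite divr_ge0 // ltW.
exists (Num.bound (24 / (al ^+ 3 * eta))).+1 => t Tt.
have /ltW : 24 / (al ^+ 3 * eta) < t%:R.
  by apply: lt_trans (archi_boundP B0) _; rewrite ltr_nat.
rewrite ler_pdivrMr // => tB.
have t1 : 1 <= t%:R :> R by rewrite ler1n (leq_trans _ Tt).
have -> : r ^+ t = (expR (al * t%:R))^-1.
  by rewrite -expRN /al mulNr opprK expRM_natr lnK.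
rewrite ler_pdivrMr ?expR_gt0 //.
(* A cubic lower bound of the exponential beats the quadratic factor. *)
have E : (al * t%:R) ^+ 3 / 6 <= expR (al * t%:R).
  apply: le_trans (expR_ge1Dxn 2 _); last by rewrite mulr_ge0 // ltW.
  by rewrite lerDr.
apply: le_trans (_ : eta * ((al * t%:R) ^+ 3 / 6) <= _); last first.
  by rewrite ler_wpM2l // ltW.
apply: le_trans (_ : 4 * t%:R ^+ 2 <= _).
  by rewrite -natr1; move: t1; nra.
have -> : eta * ((al * t%:R) ^+ 3 / 6) = t%:R * (al ^+ 3 * eta) * t%:R ^+ 2 / 6.
  by field.
have t2 : 0 <= t%:R ^+ 2 :> R by rewrite sqr_ge0.
by move: tB t2; nra.
Qed.

Lemma geometric_blocks_fast_cvg (h : nat -> R) c d D r : 0 < r < 1 -> 0 <= D ->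
    (forall t i, (i <= d)%N -> `|h (t * d.+1 + i)%N - c| <= D * r ^+ t) ->
  fast_cvg h c.
Proof.
move=> r01 D0 hD eta eta0.
pose K : R := d.+1%:R ^+ 2 * (D + 1).
have K0 : 0 < K by rewrite mulr_gt0 ?exprn_gt0 ?ltr_wpDl.
have [T HT] := sqr_geometric_le _ r01 (eta / K) (divr_gt0 eta0 K0).
exists (T * d.+1)%N => n Tn.
have := HT (n %/ d.+1)%N; rewrite leq_divRL // => /(_ Tn).
have := hD (n %/ d.+1)%N (n %% d.+1)%N; rewrite -divn_eq -ltnS ltn_pmod //.
move=> /(_ isT); set t := (n %/ _)%N => hn.
rewrite ler_pdivlMr // => HK; apply: le_trans HK.
have r0 : 0 < r ^+ t by rewrite exprn_gt0 //; case/andP: r01.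
apply: le_trans (_ : (t.+1%:R * d.+1%:R) ^+ 2 * (D * r ^+ t) <= _).
  rewrite ler_pM ?sqr_ge0 // -natrM lerXn2r ?nnegrE ?ler0n // ler_nat.
  by rewrite ltnW // -ltn_divLR.
rewrite exprMn /K; set u := t.+1%:R ^+ 2; set v := d.+1%:R ^+ 2.
have uv : 0 <= u * v * r ^+ t by rewrite !mulr_ge0 ?sqr_ge0 // ltW.
by move: uv; lra.
Qed.

Lemma ln_lipschitz_at (c x : R) : 0 < c -> `|x - c| <= c / 2 ->
  0 < x /\ `|ln x - ln c| <= 2 / c * `|x - c|.
Proof.
move=> c0 xc; have x0 : 0 < x by move: xc; rewrite ler_norml; lra.
split=> //.
have lnB (u v : R) : 0 < u -> 0 < v -> ln u - ln v <= (u - v) / v.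
  move=> u0 v0; rewrite -ln_div ?posrE // mulrBl divff ?gt_eqF //.
  rewrite -{1}[u / v](subrK 1) addrC le_ln1Dx //.
  by rewrite ltrBrDl subrr divr_gt0.
have A0 : 0 <= `|x - c| by [].
have xcA : x - c <= `|x - c| by rewrite ler_norm.
have cxA : c - x <= `|x - c| by rewrite distrC ler_norm.
rewrite mulrAC ler_norml; apply/andP; split; last first.
  apply: le_trans (lnB _ _ x0 c0) _; rewrite ler_wpM2r ?invr_ge0 ?(ltW c0) //.
  by move: A0 xcA; lra.
rewrite lerNl opprB; apply: le_trans (lnB _ _ c0 x0) _.
rewrite ler_pdivrMr // [_ / c * x]mulrAC ler_pdivlMr //.
have xc2 : c <= 2 * x by move: xc; rewrite ler_norml; lra.
by move: A0 cxA xc2 c0; nra.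
Qed.

Lemma fast_cvg_ln (h : nat -> R) (c : R) : 0 < c -> fast_cvg h c ->
  (exists N, forall n, (N <= n)%N -> 0 < h n) /\
  fast_cvg (fun n => ln (h n)) (ln c).
Proof.
move=> c0 hc.
have [N HN] := hc (c / 2) (divr_gt0 c0 (ltr0Sn _ 1)).
have near n : (maxn N 1 <= n)%N -> `|h n - c| <= c / 2.
  rewrite geq_max => /andP[/HN H n1]; apply: le_trans H.
  by rewrite ler_peMl // exprn_ege1 // ler1n.
split; first by exists (maxn N 1) => n /near /(ln_lipschitz_at _ _ c0)[].
move=> eta eta0.
have [M HM] := hc (eta * (c / 2)) (mulr_gt0 eta0 (divr_gt0 c0 (ltr0Sn _ 1))).
exists (maxn (maxn N 1) M) => n; rewrite geq_max => /andP[/near nn /HM HMn].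
have [_ Hl] := ln_lipschitz_at _ _ c0 nn.
apply: le_trans (_ : n%:R ^+ 2 * (2 / c * `|h n - c|) <= _).
  by rewrite ler_wpM2l ?sqr_ge0.
rewrite mulrCA -ler_pdivlMl ?divr_gt0 //.
by rewrite invf_div [leRHS]mulrC.
Qed.

(** Write e_m = ln (h m) and L = ln c < 0.  The term n ln lam contributes the
    constant ln lam to the logarithm of each root and drops out, so the claim is
    e_n / n + e_(n+2) / (n+2) <= 2 e_(n+1) / (n+1).  After multiplication by
    n (n+1) (n+2) and substitution of L for each e_m, the left side minus the
    right side is 2 L, since n (n+1) + (n+1) (n+2) - 2 n (n+2) = 2.  The
    deviations e_m - L have coefficients of order m^2, hence a negligible
    effect. *)
Lemma log_concave_nthroot (lam c : R) (h y : nat -> R) :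
    0 < lam -> 0 < c < 1 -> fast_cvg h c -> (forall n, y n = lam ^+ n * h n) ->
  exists N, log_concave_from N (fun n => real_nthroot n (y n)).
Proof.
move=> lam0 /andP[c0 c1] hc yE.
have [[N0 hpos] lnc] := fast_cvg_ln _ _ c0 hc.
have L0 : ln c < 0 by rewrite ln_lt0 // c0.
(* With m^2 |e_m - L| <= s, the three deviations cost at most s + 6 s + 2 s,
   where (n+1) (n+2) <= 6 n^2 gives the 6; s = - L / 9 keeps this below - 2 L. *)
have s0 : 0 < - ln c / 9 by rewrite divr_gt0 // oppr_gt0.
have [N1 HN1] := lnc _ s0.
pose N := (maxn (maxn N0 N1) 1).+1; exists N => n Nn.
have late m : (n.-1 <= m)%N ->
    0 < h m /\ m%:R ^+ 2 * `|ln (h m) - ln c| <= - ln c / 9.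
  move=> nm; have : (maxn (maxn N0 N1) 1 <= m)%N.
    by apply: leq_trans nm; rewrite -ltnS prednK // (leq_trans _ Nn).
  by rewrite !geq_max => /andP[/andP[/hpos ? /HN1 ?]].
have rootE m : (n.-1 <= m)%N ->
    real_nthroot m (y m) = expR (m%:R^-1 * (ln lam *+ m + ln (h m))).
  move=> /late[hm _].
  rewrite /real_nthroot /powR yE gt_eqF ?mulr_gt0 ?exprn_gt0 //.
  by rewrite lnM ?posrE ?exprn_gt0 // lnXn.
case: n Nn late rootE => // n; rewrite ltnS => Nn late rootE /=.
have n1 : (1 <= n)%N by move: Nn; rewrite geq_max => /andP[].
rewrite /= in late rootE; rewrite !rootE //=; last by rewrite -addn2 leq_addr.
split; first by rewrite gt_eqF ?expR_gt0.
rewrite -!expRB ler_expR.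
have [_ En] := late n (leqnn _).
have [_ En1] := late n.+1 (leqnSn _).
have [_ En2] := late n.+2 (leq_trans (leqnSn _) (leqnSn _)).
have t1 : 1 <= n%:R :> R by rewrite ler1n.
have x1E : n.+1%:R = n%:R + 1 :> R by rewrite -natr1.
have x2E : n.+2%:R = n%:R + 2 :> R by rewrite -!natr1; ring.
rewrite x1E in En1; rewrite x2E in En2.
rewrite -[ln lam *+ n]mulr_natr -[ln lam *+ n.+1]mulr_natr.
rewrite -[ln lam *+ n.+2]mulr_natr x1E x2E.
set t : R := n%:R in t1 En En1 En2 *; set l := ln lam.
set L := ln c in L0 En En1 En2 *.
set e0 := ln (h n) in En *; set e1 := ln (h n.+1) in En1 *.
set e2 := ln (h n.+2) in En2 *.
rewrite -subr_ge0.
have -> : (t + 1)^-1 * (l * (t + 1) + e1) - t^-1 * (l * t + e0) -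
    ((t + 2)^-1 * (l * (t + 2) + e2) - (t + 1)^-1 * (l * (t + 1) + e1)) =
    (2 * (t * (t + 2)) * (e1 - L) - t * (t + 1) * (e2 - L)
      - (t + 1) * (t + 2) * (e0 - L) - 2 * L) / (t * (t + 1) * (t + 2)).
  by field; rewrite !gt_eqF // ?addr_gt0 ?ltr0n.
apply: divr_ge0; last by rewrite !mulr_ge0 //; move: t1; lra.
have H2 : t * (t + 1) * (e2 - L) <= - L / 9.
  apply: le_trans En2; apply: le_trans (_ : t * (t + 1) * `|e2 - L| <= _).
    by rewrite ler_wpM2l ?ler_norm // mulr_ge0 //; move: t1; lra.
  by rewrite ler_wpM2r //; move: t1; nra.
have H0 : (t + 1) * (t + 2) * (e0 - L) <= 6 * (- L / 9).
  apply: le_trans (_ : 6 * (t ^+ 2 * `|e0 - L|) <= _); last by rewrite ler_wpM2l.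
  apply: le_trans (_ : (t + 1) * (t + 2) * `|e0 - L| <= _).
    by rewrite ler_wpM2l ?ler_norm // mulr_ge0 //; move: t1; lra.
  by rewrite mulrA ler_wpM2r //; move: t1; nra.
have H1 : t * (t + 2) * (L - e1) <= - L / 9.
  apply: le_trans En1; apply: le_trans (_ : t * (t + 2) * `|e1 - L| <= _).
    by rewrite distrC ler_wpM2l ?ler_norm // mulr_ge0 //; move: t1; lra.
  by rewrite ler_wpM2r //; move: t1; nra.
by move: H0 H1 H2 L0; lra.
Qed.
End LogConcavity.

(** * Linear recurrences with natural coefficients *)

Lemma log_concave_from_leq (R : realType) N N' (y : nat -> R) :
  (N <= N')%N -> log_concave_from N y -> log_concave_from N' y.
Proof. by move=> NN' yN n N'n; apply/yN/(leq_trans NN'). Qed.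

Section LinearRecurrence.
Variables (R : realType) (d : nat) (a : nat -> nat).
Hypotheses (d_gt0 : (0 < d)%N) (a0 : (0 < a 0)%N) (ad : (0 < a d)%N).

Variable x : R.
Hypotheses (x_ge1 : 1 <= x) (x_root : root (rec_poly R d a) x).

Let x_gt0 : 0 < x. Proof. exact: lt_le_trans x_ge1. Qed.
Let xn_neq0 n : x ^+ n != 0. Proof. by rewrite expf_neq0 // gt_eqF. Qed.

Definition rec_weight (i : nat) : R := x ^+ i *+ a i / x ^+ d.+1.

Lemma rec_weight_ge0 i : 0 <= rec_weight i.
Proof. by rewrite divr_ge0 ?mulrn_wge0 ?exprn_ge0 // ltW. Qed.

Lemma rec_weight_gt0 i : (0 < a i)%N -> 0 < rec_weight i.
Proof. by move=> ai; rewrite divr_gt0 ?exprn_gt0 // pmulrn_lgt0 ?exprn_gt0. Qed.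

Lemma rec_weight_sum1 : \sum_(i < d.+1) rec_weight i = 1.
Proof. by rewrite -mulr_suml -(root_rec_polyP _ _ _ _ x_root) divff. Qed.

Lemma sum_cumul_rec_weight :
  \sum_(i < d.+1) cumul R rec_weight i = (rec_poly R d a)^`().[x] / x ^+ d.
Proof.
rewrite sum_cumul.
have -> : (rec_poly R d a)^`().[x] / x ^+ d =
    x * (rec_poly R d a)^`().[x] / x ^+ d.+1.
  by rewrite exprS; field; rewrite xn_neq0 gt_eqF.
rewrite root_deriv_rec_poly // mulr_suml.
by apply: eq_bigr => i _; rewrite /rec_weight mulrnA !mulrnAl.
Qed.

Variable s : nat -> nat.
Hypothesis s_rec :
  forall n, s (n + d.+1)%N = (\sum_(i < d.+1) a i * s (n + i))%N.
Hypotheses (s_lt : forall n, (n < d)%N -> s n = 0%N) (s_d : s d = 1%N).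

Lemma scaled_averaging :
  averaging R d rec_weight (fun n => (s n)%:R / x ^+ n).
Proof.
move=> n; rewrite s_rec natr_sum mulr_suml; apply: eq_bigr => i _.
rewrite /rec_weight natrM !exprD -[_ *+ a i]mulr_natl; field.
by rewrite !xn_neq0.
Qed.

(** On the initial window only h_d = 1 / x^d is nonzero, with coefficient
    [cumul d] = 1, and the coefficients sum to P'(x) / x^d. *)
Lemma scaled_limit :
  average_limit R d rec_weight (fun n => (s n)%:R / x ^+ n) =
  ((rec_poly R d a)^`().[x])^-1.
Proof.
rewrite /average_limit sum_cumul_rec_weight big_ord_recr big1 /=; last first.
  by move=> i _; rewrite s_lt // mul0r mulr0.
rewrite add0r s_d {1}/cumul rec_weight_sum1 invf_div; field.
rewrite xn_neq0 gt_eqF // (lt_trans ltr01) //.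
exact: rec_poly_deriv_gt1.
Qed.

Lemma rec_log_concave :
  exists N, log_concave_from N (fun n => real_nthroot n ((s n)%:R : R)).
Proof.
have D1 := rec_poly_deriv_gt1 R d a d_gt0 a0 ad x x_ge1 x_root.
apply: (log_concave_nthroot _ x ((rec_poly R d a)^`().[x])^-1
         (fun n => (s n)%:R / x ^+ n)) => //.
- by rewrite invr_gt0 invf_lt1 ?D1 ?(lt_trans ltr01).
- have w0 := rec_weight_gt0 _ a0; have wd := rec_weight_gt0 _ ad.
  have [D D0 HD] := averaging_geometric R d rec_weight rec_weight_ge0
    rec_weight_sum1 w0 _ scaled_averaging.
  rewrite -scaled_limit.
  apply: (geometric_blocks_fast_cvg _ _ _ d _ _ _ D0 HD).
  have g0 := gain_gt0 R d rec_weight w0 wd.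
  have g1 := gain_lt1 R d rec_weight rec_weight_ge0 rec_weight_sum1.
  by rewrite subr_gt0 g1 /= gtrBl.
- by move=> n; rewrite mulrC divfK.
Qed.

End LinearRecurrence.

(** * The two families of sequences *)

Lemma f_charpolyE (A : nzRingType) d :
  f_charpoly A d.+1 = rec_poly A d (fun=> 1%N).
Proof. by []. Qed.

Lemma g_charpolyE (A : nzRingType) d :
  g_charpoly A d.+1 = rec_poly A d (fun i => (i == 0) + (i == d))%N.
Proof.
rewrite /g_charpoly /rec_poly -addrA -opprD; congr (_ - _).
under eq_bigr do rewrite mulrnDr.
rewrite big_split big_ord_recl [X in _ = _ + X]big_ord_recr /= eqxx.
rewrite !big1 ?addr0 ?add0r 1?addrC // => i _.
by rewrite ltn_eqF.
Qed.

Lemma f_sequence_rec d f : f_sequence d.+1 f ->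
  forall n, f (n + d.+1)%N = (\sum_(i < d.+1) 1 * f (n + i))%N.
Proof.
move=> [_ _ fS] n; rewrite fS ?leq_addl // big_add1 big_mkord.
rewrite (reindex_inj rev_ord_inj); apply: eq_bigr => i _ /=.
by rewrite mul1n subSS addnS subSS -addnBA ?leq_subr // subKn // -ltnS.
Qed.

Lemma g_sequence_rec d g : (0 < d)%N -> g_sequence d.+1 g ->
  forall n, g (n + d.+1)%N =
    (\sum_(i < d.+1) ((i == 0 :> nat) + (i == d :> nat)) * g (n + i))%N.
Proof.
move=> d0 [_ _ gS] n; rewrite gS ?leq_addl // addnK addnS subn1 /=.
under eq_bigr do rewrite mulnDl.
rewrite big_split big_ord_recl [X in _ = (_ + X)%N]big_ord_recr /= eqxx.
rewrite !big1 /= ?addn0 ?mul1n ?add0n 1?addnC // => i _.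
by rewrite ltn_eqF.
Qed.

(* In R[i], [1 < c] means that c is real and greater than 1. The bound 2 <= N
   keeps n.-1 >= 1, so that only n-th roots with n >= 1 are involved. *)
Theorem theorem2p7 (R : realType) (k : nat) (hk : (2 <= k)%N)
    (f g : nat -> nat) (hf : f_sequence k f) (hg : g_sequence k g) :
  [/\ exists z : R[i],
        dominant_zero (f_charpoly R[i] k) z /\ 1 < (f_charpoly R[i] k)^`().[z],
      exists z : R[i],
        dominant_zero (g_charpoly R[i] k) z /\ 1 < (g_charpoly R[i] k)^`().[z]
    & exists N : nat,
        [/\ (2 <= N)%N,
            log_concave_from N (fun n => real_nthroot n ((f n)%:R : R))
          & log_concave_from N (fun n => real_nthroot n ((g n)%:R : R))]].
Proof.
case: k hk hf hg => // d d0 hf hg.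
pose b i := ((i == 0) + (i == d))%N.
have bd : (0 < b d)%N by rewrite /b eqxx addn1.
have [x x1 xr] := rec_poly_root_ge1 R d (fun=> 1%N) isT.
have [z z1 zr] := rec_poly_root_ge1 R d b isT.
have [N1 H1] : exists N,
    log_concave_from N (fun n => real_nthroot n ((f n)%:R : R)).
  have [f0 f1 _] := hf.
  apply: (rec_log_concave R d (fun=> 1%N) _ _ _ x) => //.
  exact: f_sequence_rec.
have [N2 H2] : exists N,
    log_concave_from N (fun n => real_nthroot n ((g n)%:R : R)).
  have [g0 g1 _] := hg.
  by apply: (rec_log_concave R d b _ _ _ z) => //; apply: g_sequence_rec.
split.
- by exists (x%:C)%C; rewrite f_charpolyE; apply: rec_poly_dominant_zero.
- by exists (z%:C)%C; rewrite g_charpolyE; apply: rec_poly_dominant_zero.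
exists (maxn 2 (maxn N1 N2)); split; first exact: leq_maxl.
  by apply: log_concave_from_leq H1; rewrite !leq_max leqnn !orbT.
by apply: log_concave_from_leq H2; rewrite !leq_max leqnn !orbT.
Qed.
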